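(* Let $A_0=\begin{bmatrix} a_{11} & a_{12}\\ a_{21} & a_{22}\end{bmatrix}$ be a real $2\times 2$ matrix with strictly positive entries and $\det(A_0)=0$. Let $\varepsilon\mapsto a_{12}(\varepsilon)$ be a continuous function of $\varepsilon>0$ such that, for every $\varepsilon>0$, the matrix $A(\varepsilon)=\begin{bmatrix} a_{11} & a_{12}(\varepsilon)\\ a_{21} & a_{22}\end{bmatrix}$ has strictly positive entries and is nonsingular, and such that $\lim_{\varepsilon\to 0}a_{12}(\varepsilon)=a_{12}$ (so that $\lim_{\varepsilon\to0}A(\varepsilon)=A_0$ and $\lim_{\varepsilon\to0}\det(A(\varepsilon))=0$), the limits being taken through $\varepsilon>0$. Let $\mathbf{R}=(R_1,R_2)^\top\in\mathbb{R}^2_{>0}$ and $\mathbf{C}=(C_1,C_2)^\top\in\mathbb{R}^2_{>0}$ be target row and column sums with $R_1+R_2=C_1+C_2$. Put $\alpha=a_{11}a_{22}$, $\beta(\varepsilon)=a_{12}(\varepsilon)a_{21}$, and $\Delta=\Delta(\varepsilon)=\bigl(\alpha(C_2+R_2)+\beta(\varepsilon)(C_1-R_2)\bigr)^2-4\alpha C_2R_2\det(A(\varepsilon))$. Then $$\operatorname{Sink}(A_0\mid\mathbf{R},\mathbf{C})=\lim_{\varepsilon\to 0}\begin{bmatrix} \dfrac{\alpha(R_2 - 2 C_1 - C_2)+\beta(\varepsilon)(- R_2 + C_1)+\sqrt{\Delta}}{-2\det(A(\varepsilon))} & \dfrac{\alpha(R_2 - C_2)+\beta(\varepsilon)(-R_2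 + C_1 + 2 C_2)-\sqrt{\Delta}}{-2\det(A(\varepsilon))} \\[2ex] \dfrac{\alpha(-R_2+C_2)+\beta(\varepsilon)(R_2+C_1)-\sqrt{\Delta}}{-2\det(A(\varepsilon))} & \dfrac{\alpha(-R_2-C_2)+\beta(\varepsilon)(R_2-C_1)+\sqrt{\Delta}}{-2\det(A(\varepsilon))} \end{bmatrix}$$ $$=\begin{bmatrix} C_1-\dfrac{C_1 R_2}{C_1+C_2} & C_2-\dfrac{C_2 R_2}{C_1+C_2} \\[2ex] \dfrac{C_1 R_2}{C_1+C_2} & \dfrac{C_2 R_2}{C_1+C_2} \end{bmatrix}.$$
   Context: Generalized Sinkhorn limit: let $A\in\mathbb{R}^{n\times m}_{>0}$ be a matrix with strictly positive entries, and let $\mathbf{R}\in\mathbb{R}^n_{>0}$, $\mathbf{C}\in\mathbb{R}^m_{>0}$ satisfy the consistency condition $\sum_i R_i=\sum_j C_j$. The generalized Sinkhorn limit $\operatorname{Sink}(A\mid\mathbf{R},\mathbf{C})$ is the matrix $S=D_1AD_2$, where $D_1=\operatorname{diag}(r_1,\dots,r_n)$ and $D_2=\operatorname{diag}(c_1,\dots,c_m)$ are diagonal matrices with strictly positive diagonal entries such that $S\mathbf{1}_m=\mathbf{R}$ and $S^\top\mathbf{1}_n=\mathbf{C}$; here $\mathbf{1}_k$ is the column vector of $k$ ones. It is a known theorem of Sinkhorn that such $D_1,D_2$ exist and are unique up to $D_1\mapsto\lambda D_1$, $D_2\mapsto\lambda^{-1}D_2$ with $\lambda>0$, so that $S$ exists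 and is unique. *)

(* Defs.v *)
From mathcomp Require Import all_boot all_order all_algebra.
From mathcomp Require Import all_classical all_reals all_analysis.
Import Order.TTheory GRing.Theory Num.Theory.
Import numFieldNormedType.Exports.

Set Implicit Arguments.
Unset Strict Implicit.
Unset Printing Implicit Defensive.

Local Open Scope classical_set_scope.
Local Open Scope ring_scope.

Definition mx2 {K : realType} (a b c d : K) : 'M[K]_2 :=
  \matrix_(i < 2, j < 2)
    if i == 0 then (if j == 0 then a else b) else (if j == 0 then c else d).

Definition col2 {K : realType} (a b : K) : 'cV[K]_2 :=
  \col_(i < 2) if i == 0 then a else b.

Definition pos_mx {K : realType} {n m : nat} (A : 'M[K]_(n, m)) : Prop :=
  forall i j, 0 < A i j.

Definition is_sink {K : realType} {n m : nat} (A : 'M[K]_(n, m))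
    (R : 'cV[K]_n) (C : 'cV[K]_m) (S : 'M[K]_(n, m)) : Prop :=
  exists (r : 'rV[K]_n) (c : 'rV[K]_m),
    [/\ pos_mx r, pos_mx c,
        S = diag_mx r *m A *m diag_mx c,
        S *m (const_mx 1 : 'cV[K]_m) = R
      & S^T *m (const_mx 1 : 'cV[K]_n) = C].

(* By Sinkhorn's theorem there is exactly one [S] with [is_sink A R C S] when
   [A], [R] and [C] are positive and [R] and [C] have the same sum. The default
   value 0 is only taken when there is no such [S]. *)
Definition Sink {K : realType} {n m : nat} (A : 'M[K]_(n, m))
    (R : 'cV[K]_n) (C : 'cV[K]_m) : 'M[K]_(n, m) :=
  xget 0 [set S | is_sink A R C S].

(* Main.v *)
Require Import Defs.
From mathcomp Require Import all_boot all_order all_algebra.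
From mathcomp Require Import all_classical all_reals all_analysis.
From mathcomp Require Import ring.
Import Order.TTheory GRing.Theory Num.Theory.
Import numFieldNormedType.Exports.

Local Open Scope classical_set_scope.
Local Open Scope ring_scope.

(** In a matrix with prescribed margins R and C, all entries are affine in the
    lower right entry x, namely C1 - R2 + x, C2 - x, R2 - x and x.  Diagonal
    scaling preserves the cross ratio alpha / beta of A, so the entry x of the
    Sinkhorn limit of A is a root of
    [d * x ^+ 2 - u * x + p = 0],  with  d = \det A = alpha - beta,
    u = alpha * (C2 + R2) + beta * (C1 - R2),  p = alpha * C2 * R2.
    The displayed matrix is made from the root given by the quadratic formula
    with minus the square root.  As d tends to 0 the equation degenerates to a
    linear one, and this root, unlike the other one, stays bounded: it tends
    to the root p / u of the linear equation ([small_root_cvg]).  At d = 0,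
    alpha = beta and u = alpha * (C1 + C2), hence p / u = C2 * R2 / (C1 + C2).

    On the other side, A0 is singular, i.e. of rank one, and then the Sinkhorn
    limit depends only on the margins: it is the matrix R C^T divided by the
    common total of R and C ([Sink_rank1]). *)

Lemma cvg_mx (K : realType) (m n : nat) (T : Type) (F : set_system T)
    (FF : Filter F) (f : T -> 'M[K]_(m, n)) (L : 'M[K]_(m, n)) :
  (forall i j, f x i j @[x --> F] --> L i j) -> f x @[x --> F] --> L.
Proof.
move=> fL; apply/cvg_ballP => e e0.
have H : \forall x \near F, forall i j, ball (L i j) e (f x i j).
  apply: filter_forall => i; apply: filter_forall => j.
  exact: (cvg_ball (fL i j) e0).
by apply: filterS H => x H; split.
Qed.

Lemma cvg_mx2 (K : realType) (T : Type) (F : set_system T) (FF : Filter F)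
    (f g h k : T -> K) (a b c d : K) :
  f x @[x --> F] --> a -> g x @[x --> F] --> b ->
  h x @[x --> F] --> c -> k x @[x --> F] --> d ->
  mx2 (f x) (g x) (h x) (k x) @[x --> F] --> mx2 a b c d.
Proof.
move=> fa gb hc kd; apply: cvg_mx => i j; rewrite mxE.
under eq_fun do rewrite mxE.
by case: (i == 0); case: (j == 0).
Qed.

Lemma det_mx2 (K : realType) (a b c d : K) : \det (mx2 a b c d) = a * d - b * c.
Proof.
rewrite (expand_det_row _ 0) big_ord_recl big_ord1 /cofactor !det_mx11 !mxE /=.
by ring.
Qed.

(** A scaled rank-one matrix is again of the form [S i j = s i * t j], so the
    product of its i-th row sum and j-th column sum is [S i j] times the sum of
    all entries: the margins determine S. *)
Lemma Sink_rank1 (K : realType) (n m : nat) (u : 'cV[K]_n) (v : 'rV[K]_m)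
    (R : 'cV[K]_n) (C : 'cV[K]_m) :
  pos_mx u -> pos_mx v -> pos_mx R -> pos_mx C ->
  \sum_i R i 0 = \sum_j C j 0 -> 0 < \sum_i R i 0 ->
  Sink (u *m v) R C = (\sum_i R i 0)^-1 *: (R *m C^T).
Proof.
move=> u0 v0 R0 C0 RC; set N := \sum_i R i 0 => N0.
have Nn0 : N != 0 by rewrite gt_eqF.
have scaledE (r : 'rV[K]_n) (c : 'rV[K]_m) i j :
    (diag_mx r *m (u *m v) *m diag_mx c) i j = r 0 i * u i 0 * (v 0 j * c 0 j).
  by rewrite mul_mx_diag mul_diag_mx !mxE big_ord1; ring.
apply: xget_unique.
- exists (\row_i (R i 0 / u i 0)), (\row_j (C j 0 / (N * v 0 j))); split.
  + by move=> i j; rewrite !mxE divr_gt0.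
  + by move=> i j; rewrite !mxE divr_gt0 // mulr_gt0.
  + apply/matrixP => i j; rewrite scaledE !mxE big_ord1 !mxE.
    have ui : u i 0 != 0 by rewrite gt_eqF.
    have vj : v 0 j != 0 by rewrite gt_eqF.
    by field; rewrite Nn0 ui vj.
  + apply/colP => i; rewrite !mxE.
    under eq_bigr do rewrite !mxE big_ord1 !mxE mulr1 mulrA.
    by rewrite -mulr_sumr -RC -/N mulrAC mulVf // mul1r.
  + apply/colP => j; rewrite !mxE.
    under eq_bigr do rewrite !mxE big_ord1 !mxE mulr1 mulrA mulrAC.
    by rewrite -mulr_sumr -/N mulrAC mulVf // mul1r.
- move=> S [r [c [_ _ SE SR SC]]].
  pose s i := r 0 i * u i 0; pose t j := v 0 j * c 0 j.
  have Sst i j : S i j = s i * t j by rewrite SE scaledE.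
  have RE i : R i 0 = s i * \sum_j t j.
    by rewrite -SR mxE mulr_sumr; apply: eq_bigr => j _; rewrite Sst mxE mulr1.
  have CE j : C j 0 = (\sum_i s i) * t j.
    rewrite -SC mxE mulr_suml; apply: eq_bigr => i _.
    by rewrite mxE Sst mxE mulr1.
  have NE : N = (\sum_i s i) * \sum_j t j.
    by rewrite mulr_suml; apply: eq_bigr => i _; rewrite RE.
  apply/matrixP => i j; rewrite !mxE big_ord1 mxE RE CE Sst.
  apply: (mulfI Nn0); rewrite [RHS]mulrA mulfV // mul1r NE; ring.
Qed.

Lemma Sink_mx2_singular {K : realType} {a b c d R1 R2 C1 C2 : K} :
  pos_mx (mx2 a b c d) -> \det (mx2 a b c d) = 0 ->
  pos_mx (col2 R1 R2) -> pos_mx (col2 C1 C2) -> R1 + R2 = C1 + C2 ->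
  Sink (mx2 a b c d) (col2 R1 R2) (col2 C1 C2) =
  mx2 (C1 - C1 * R2 / (C1 + C2)) (C2 - C2 * R2 / (C1 + C2))
      (C1 * R2 / (C1 + C2))      (C2 * R2 / (C1 + C2)).
Proof.
move=> A0; rewrite det_mx2 => /eqP; rewrite subr_eq0 => /eqP ad_bc R0 C0 RC.
have a0 : 0 < a by move: (A0 0 0); rewrite mxE.
have b0 : 0 < b by move: (A0 0 1); rewrite mxE.
have c0 : 0 < c by move: (A0 1 0); rewrite mxE.
have C10 : 0 < C1 by move: (C0 0 0); rewrite mxE.
have C20 : 0 < C2 by move: (C0 1 0); rewrite mxE.
have N0 : C1 + C2 != 0 by rewrite gt_eqF // addr_gt0.
have sumR : \sum_i col2 R1 R2 i 0 = C1 + C2.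
  by rewrite big_ord_recl big_ord1 !mxE /= RC.
have sumC : \sum_i col2 C1 C2 i 0 = C1 + C2.
  by rewrite big_ord_recl big_ord1 !mxE.
have -> : mx2 a b c d
    = col2 1 (c / a) *m (\row_(j < 2) if j == 0 then a else b).
  apply/matrixP => i j; rewrite !mxE big_ord1 !mxE.
  case: (i == 0); case: (j == 0); rewrite ?mul1r //.
    by rewrite mulfVK ?gt_eqF.
  by rewrite mulrAC [c * b]mulrC -ad_bc mulrAC mulfV ?mul1r ?gt_eqF.
(* The upper left entry of R C^T / N is C1 * R1 / N, and R1 = N - R2. *)
rewrite Sink_rank1 // ?sumR ?sumC ?addr_gt0 //.
- apply/matrixP => i j; rewrite !mxE big_ord1 !mxE.
  have -> : R1 = C1 + C2 - R2 by rewrite -RC addrK.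
  by case: (i == 0); case: (j == 0); field.
- by move=> i j; rewrite mxE; case: ifP => // _; rewrite divr_gt0.
- by move=> i j; rewrite mxE; case: ifP.
Qed.

(** Multiplying by the conjugate turns the root of [d x ^ 2 - u x + p] with
    minus the square root into [2 p / (u + sqrt (u ^ 2 - 4 p d))], which is
    continuous at [d = 0]. *)
Lemma small_root_cvg (K : realType) (T : Type) (F : set_system T)
    (FF : Filter F) (u d : T -> K) (u0 p : K) :
  0 < u0 -> u x @[x --> F] --> u0 -> d x @[x --> F] --> 0 ->
  (\forall x \near F, d x != 0) ->
  (- u x + Num.sqrt (u x ^+ 2 - 4 * p * d x)) / (- 2 * d x) @[x --> F]
    --> p / u0.
Proof.
move=> u0_gt0 uu0 d0 dn0.
have disc_cvg : u x ^+ 2 - 4 * p * d x @[x --> F] --> u0 ^+ 2.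
  have -> : u0 ^+ 2 = u0 * u0 - 4 * p * 0 by ring.
  by apply: cvgB; [exact: cvgM | apply: cvgM => //; exact: cvg_cst].
have sqrt_cvg : Num.sqrt (u x ^+ 2 - 4 * p * d x) @[x --> F] --> u0.
  have -> : u0 = Num.sqrt (u0 ^+ 2) by rewrite sqrtr_sqr gtr0_norm.
  by apply: continuous_cvg => //; exact: sqrt_continuous.
have cvg2 : 2 * p / (u x + Num.sqrt (u x ^+ 2 - 4 * p * d x)) @[x --> F]
    --> p / u0.
  have -> : p / u0 = 2 * p / (u0 + u0).
    by field; rewrite !gt_eqF // addr_gt0.
  apply: cvgM; first exact: cvg_cst.
  by apply: cvgV; [rewrite gt_eqF // addr_gt0 | exact: cvgD].
apply: cvg_trans cvg2; apply: near_eq_cvg; near=> x.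
have disc_ge0 : 0 <= u x ^+ 2 - 4 * p * d x.
  by apply/ltW; near: x; apply: (cvgr_gt _ disc_cvg); rewrite exprn_gt0.
have u_gt0 : 0 < u x by near: x; apply: (cvgr_gt _ uu0).
have dx : d x != 0 by near: x.
have := sqr_sqrtr disc_ge0.
have := sqrtr_ge0 (u x ^+ 2 - 4 * p * d x).
move: (Num.sqrt _) => s s0 s2.
have us : u x + s != 0 by rewrite gt_eqF // ltr_wpDr.
have -> : p = (u x ^+ 2 - s ^+ 2) / (4 * d x).
  by rewrite s2; field.
by field; rewrite dx us.
Unshelve. all: by end_near. Qed.

Theorem corollary2p3p1 (K : realType) (a11 a12 a21 a22 : K) (a12e : K -> K)
    (R1 R2 C1 C2 : K)
    (A0_pos : pos_mx (mx2 a11 a12 a21 a22))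
    (A0_sing : \det (mx2 a11 a12 a21 a22) = 0)
    (a12e_cont : {within `]0, +oo[, continuous a12e})
    (A_pos : forall e : K, 0 < e -> pos_mx (mx2 a11 (a12e e) a21 a22))
    (A_unit : forall e : K, 0 < e -> mx2 a11 (a12e e) a21 a22 \in unitmx)
    (a12e_lim : a12e e @[e --> 0^'+] --> a12)
    (R_pos : pos_mx (col2 R1 R2)) (C_pos : pos_mx (col2 C1 C2))
    (RC_sum : R1 + R2 = C1 + C2) :
  let A0 := mx2 a11 a12 a21 a22 in
  let A := fun e : K => mx2 a11 (a12e e) a21 a22 in
  let R := col2 R1 R2 in
  let C := col2 C1 C2 in
  let alpha := a11 * a22 in
  let beta := fun e : K => a12e e * a21 in
  let Delta := fun e : K =>
    (alpha * (C2 + R2) + beta e * (C1 - R2)) ^+ 2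
    - 4 * alpha * C2 * R2 * \det (A e) in
  (mx2
     ((alpha * (R2 - 2 * C1 - C2) + beta e * (- R2 + C1)
       + Num.sqrt (Delta e)) / (- 2 * \det (A e)))
     ((alpha * (R2 - C2) + beta e * (- R2 + C1 + 2 * C2)
       - Num.sqrt (Delta e)) / (- 2 * \det (A e)))
     ((alpha * (- R2 + C2) + beta e * (R2 + C1)
       - Num.sqrt (Delta e)) / (- 2 * \det (A e)))
     ((alpha * (- R2 - C2) + beta e * (R2 - C1)
       + Num.sqrt (Delta e)) / (- 2 * \det (A e)))
     @[e --> 0^'+] --> Sink A0 R C)
  /\ Sink A0 R C =
     mx2 (C1 - C1 * R2 / (C1 + C2)) (C2 - C2 * R2 / (C1 + C2))
         (C1 * R2 / (C1 + C2))      (C2 * R2 / (C1 + C2)).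
Proof.
move=> A0 A R C alpha beta Delta.
have SinkE := Sink_mx2_singular A0_pos A0_sing R_pos C_pos RC_sum.
split; last exact: SinkE.
rewrite SinkE; move: A0_sing; rewrite det_mx2 => /eqP.
rewrite subr_eq0 => /eqP alpha_beta.
have alpha0 : 0 < alpha.
  by move: (A0_pos 0 0) (A0_pos 1 1); rewrite !mxE /=; exact: mulr_gt0.
have C10 : 0 < C1 by move: (C_pos 0 0); rewrite mxE.
have C20 : 0 < C2 by move: (C_pos 1 0); rewrite mxE.
have N0 : 0 < C1 + C2 by rewrite addr_gt0.
pose u e := alpha * (C2 + R2) + beta e * (C1 - R2).
pose x e := (- u e + Num.sqrt (Delta e)) / (- 2 * \det (A e)).
have beta_cvg : beta e @[e --> 0^'+] --> alpha.
  by rewrite /alpha alpha_beta; apply: cvgM => //; exact: cvg_cst.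
have detE e : \det (A e) = alpha - beta e by rewrite det_mx2.
have det_neq0 : \forall e \near 0^'+, \det (A e) != 0.
  near=> e; rewrite -unitfE -unitmxE; apply: A_unit.
  by near: e; exact: nbhs_right_gt.
have x_cvg : x e @[e --> 0^'+] --> C2 * R2 / (C1 + C2).
  have -> : C2 * R2 / (C1 + C2) = alpha * C2 * R2 / (alpha * (C1 + C2)).
    by field; rewrite !gt_eqF.
  rewrite /x /Delta.
  rewrite (_ : 4 * alpha * C2 * R2 = 4 * (alpha * C2 * R2)); last by ring.
  apply: small_root_cvg; first exact: mulr_gt0.
  - have -> : alpha * (C1 + C2) = alpha * (C2 + R2) + alpha * (C1 - R2) by ring.
    by apply: cvgD; [exact: cvg_cst | apply: cvgM => //; exact: cvg_cst].
  - under eq_fun do rewrite detE.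
    have : alpha - beta e @[e --> 0^'+] --> alpha - alpha.
      by apply: cvgB => //; exact: cvg_cst.
    by rewrite subrr.
  - exact: det_neq0.
(* These entries are the displayed ones: the margin equations for x. *)
have entries_cvg : mx2 (C1 - (R2 - x e)) (C2 - x e) (R2 - x e) (x e)
    @[e --> 0^'+] --> mx2 (C1 - C1 * R2 / (C1 + C2)) (C2 - C2 * R2 / (C1 + C2))
                          (C1 * R2 / (C1 + C2)) (C2 * R2 / (C1 + C2)).
  have -> : C1 * R2 / (C1 + C2) = R2 - C2 * R2 / (C1 + C2).
    by field; rewrite gt_eqF.
  by apply: cvg_mx2 => //; do ?[apply: cvgB => //]; exact: cvg_cst.
apply: cvg_trans entries_cvg; apply: near_eq_cvg; near=> e.
have : \det (A e) != 0 by near: e.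
rewrite /x /u detE; move: (Num.sqrt _) (beta e) => s b d0.
by congr mx2; field.
Unshelve. all: by end_near. Qed.
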